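(* Let $n,p$ be positive integers and let $f:\mathbb{R}^n\to\mathbb{R}^p$ be an arbitrary bounded-input bounded-output function. Then there exist an integer $m\ge p+n$, a real unitary (i.e. orthogonal) matrix $U\in\mathbb{R}^{p\times p}$, a real, non-negative, rectangular-diagonal matrix $\Sigma\in\mathbb{R}^{p\times m}$ with diagonal entries $\sigma_1\ge\sigma_2\ge\dots\ge\sigma_p\ge 0$, and a norm-preserving, injective mapping $v:\mathbb{R}^n\to\mathbb{R}^m$ such that $$f(x)=U\,\Sigma\,v(x)\qquad\text{for all }x\in\mathbb{R}^n,$$ and such that $\sigma_1$, the maximum entry of $\Sigma$, is an upper bound on the 2-induced norm of $f$ in the sense that $$\|f\|_{2-2}\,\|x\|_2<\|x\|_2\,\sigma_1\qquad\text{for all }x\in\mathbb{R}^n\setminus\{0\}.$$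
   Context: A function $f:\mathbb{R}^n\to\mathbb{R}^p$ (not assumed linear or continuous) is called bounded-input bounded-output if there is a finite constant $c>0$ such that $\|f(x)\|_2\le c\|x\|_2$ for all $x\in\mathbb{R}^n$. Its 2-induced norm is $\|f\|_{2-2}=\sup_{x\ne 0}\frac{\|f(x)\|_2}{\|x\|_2}$. A mapping $v:\mathbb{R}^n\to\mathbb{R}^m$ (not assumed linear or continuous) is norm-preserving if $\|v(x)\|_2=\|x\|_2$ for all $x\in\mathbb{R}^n$, where $\|\cdot\|_2$ is the Euclidean norm. A matrix $\Sigma\in\mathbb{R}^{p\times m}$ is rectangular-diagonal if $\Sigma_{ij}=0$ whenever $i\ne j$; its $i$-th diagonal entry is denoted $\sigma_i$. *)

(* Defs.v *)
From HB Require Import structures.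
From mathcomp Require Import all_boot all_order all_algebra.
From mathcomp Require Import classical_sets reals.
Set Implicit Arguments.
Unset Strict Implicit.
Unset Printing Implicit Defensive.
Import Order.TTheory GRing.Theory Num.Theory.
Local Open Scope classical_set_scope.
Local Open Scope ring_scope.

(* Euclidean norm; MathComp-Analysis' `|x| on matrices is the sup norm. *)
Definition norm2 (R : realType) (n : nat) (x : 'cV[R]_n) : R :=
  Num.sqrt (\sum_(i < n) x i 0 ^+ 2).

Definition bibo (R : realType) (n p : nat) (f : 'cV[R]_n -> 'cV[R]_p) : Prop :=
  exists2 c : R, 0 < c & forall x, norm2 (f x) <= c * norm2 x.

Definition gains (R : realType) (n p : nat) (f : 'cV[R]_n -> 'cV[R]_p) : set R :=
  [set norm2 (f x) / norm2 x | x in [set x | x != 0]].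

(* [sup] is a genuine supremum here as soon as 0 < n and f is bounded-input
   bounded-output: see [has_sup_gains]. *)
Definition induced_norm (R : realType) (n p : nat)
    (f : 'cV[R]_n -> 'cV[R]_p) : R := sup (gains f).

Definition norm_preserving (R : realType) (n m : nat)
    (v : 'cV[R]_n -> 'cV[R]_m) : Prop := forall x, norm2 (v x) = norm2 x.

(* Real unitary matrix; MathComp's [unitarymx] requires a closed field. *)
Definition orthogonal_mx (R : realType) (p : nat) (U : 'M[R]_p) : Prop :=
  U *m U^T = 1%:M /\ U^T *m U = 1%:M.

(* The indices are 0-based: the i-th diagonal entry sits at (i - 1). *)
Definition diag_entry (R : realType) (p m : nat) (lepm : (p <= m)%N)
    (S : 'M[R]_(p, m)) (i : 'I_p) : R := S i (widen_ord lepm i).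

Lemma norm2_gt0 (R : realType) (n : nat) (x : 'cV[R]_n) :
  x != 0 -> 0 < norm2 x.
Proof.
move=> x0; rewrite sqrtr_gt0 lt_neqAle sumr_ge0 ?andbT => [|i _]; last exact: sqr_ge0.
apply: contraNneq x0 => /esym/eqP; rewrite psumr_eq0 => [/allP h|i _]; last exact: sqr_ge0.
apply/eqP/colP => i; rewrite mxE.
by have := h i (mem_index_enum i); rewrite /= sqrf_eq0 => /eqP.
Qed.

Lemma has_sup_gains (R : realType) (n p : nat) (f : 'cV[R]_n -> 'cV[R]_p) :
  (0 < n)%N -> bibo f -> has_sup (gains f).
Proof.
move=> n0 [c _ fc]; split.
  exists (norm2 (f (const_mx 1)) / norm2 (const_mx 1 : 'cV[R]_n)).
  exists (const_mx 1) => //=; apply/eqP => /colP/(_ (Ordinal n0)).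
  by rewrite !mxE => /eqP; rewrite oner_eq0.
by exists c => _ [x /= x0 <-]; rewrite ler_pdivrMr ?norm2_gt0.
Qed.

(* Main.v *)
(** The gain of [f] is finite, so pick [s] strictly above it.  Then [f x / s] is
    strictly shorter than [x] for [x != 0], and stacking it on the positive
    multiple of [x] that restores the norm gives
    [v x = (f x / s, sqrt (1 - (|f x| / (s |x|))^2) x)], with [U = 1] and
    [Sigma = (s 1 | 0)].  The map [v] is injective because the multiple depends
    only on [|f x|] and [|x|], both of which are determined by [v x]. *)
Require Import Defs.
From HB Require Import structures.
From mathcomp Require Import all_boot all_order all_algebra.
From mathcomp Require Import classical_sets reals.
From mathcomp Require Import ring.
Set Implicit Arguments.
Unset Strict Implicit.
Unset Printing Implicit Defensive.
Import Order.TTheory GRing.Theory Num.Theory.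
Local Open Scope ring_scope.

Section Norm2.
Variable R : realType.

Lemma norm2_ge0 n (x : 'cV[R]_n) : 0 <= norm2 x.
Proof. exact: sqrtr_ge0. Qed.

Lemma norm2_0 n : norm2 (0 : 'cV[R]_n) = 0.
Proof.
by rewrite /norm2 big1 ?sqrtr0 // => i _; rewrite mxE expr0n.
Qed.

Lemma norm2_eq0 n (x : 'cV[R]_n) : (norm2 x == 0) = (x == 0).
Proof.
have [->|/norm2_gt0/lt0r_neq0/negbTE//] := eqVneq x 0.
by rewrite norm2_0 eqxx.
Qed.

Lemma sqr_norm2 n (x : 'cV[R]_n) : norm2 x ^+ 2 = \sum_(i < n) x i 0 ^+ 2.
Proof. by rewrite sqr_sqrtr // sumr_ge0 // => i _; exact: sqr_ge0. Qed.

Lemma sqr_norm2Z n (a : R) (x : 'cV[R]_n) :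
  norm2 (a *: x) ^+ 2 = a ^+ 2 * norm2 x ^+ 2.
Proof.
by rewrite !sqr_norm2 mulr_sumr; apply: eq_bigr => i _; rewrite mxE exprMn.
Qed.

Lemma sqr_norm2_col_mx n m (x : 'cV[R]_n) (y : 'cV[R]_m) :
  norm2 (col_mx x y) ^+ 2 = norm2 x ^+ 2 + norm2 y ^+ 2.
Proof.
rewrite !sqr_norm2 big_split_ord /=.
by congr (_ + _); apply: eq_bigr => i _; rewrite ?col_mxEu ?col_mxEd.
Qed.

End Norm2.

Section InducedNorm.
Variables (R : realType) (n p : nat) (f : 'cV[R]_n -> 'cV[R]_p).
Hypotheses (n_gt0 : (0 < n)%N) (f_bibo : bibo f).

Lemma bibo0 : f 0 = 0.
Proof.
case: f_bibo => c _ /(_ 0); rewrite norm2_0 mulr0 => f0.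
by apply/eqP; rewrite -norm2_eq0 eq_le f0 norm2_ge0.
Qed.

Lemma gain_le_induced_norm x : x != 0 -> norm2 (f x) / norm2 x <= induced_norm f.
Proof.
move=> x0; have [_ ubf] := has_sup_gains n_gt0 f_bibo.
by apply: ub_le_sup => //; exists x.
Qed.

(** Since [0 < n], some nonzero vector exists; its gain is non-negative and lies below the
    supremum. *)
Lemma induced_norm_ge0 : 0 <= induced_norm f.
Proof.
have [[_ [x /= x0 _]] _] := has_sup_gains n_gt0 f_bibo.
by apply: le_trans (gain_le_induced_norm x0); rewrite divr_ge0 ?norm2_ge0.
Qed.

End InducedNorm.

Section Dilation.
Variables (R : realType) (n p : nat) (f : 'cV[R]_n -> 'cV[R]_p) (s : R).

(* At [x = 0] the quotient is [0] by convention and the factor is [1]. *)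
Definition defect (x : 'cV[R]_n) : R :=
  Num.sqrt (1 - (norm2 (f x) / (s * norm2 x)) ^+ 2).

Definition dilation (x : 'cV[R]_n) : 'cV[R]_(p + n) :=
  col_mx (s^-1 *: f x) (defect x *: x).

Hypotheses (n_gt0 : (0 < n)%N) (f_bibo : bibo f) (f_lt_s : induced_norm f < s).

Let s_gt0 : 0 < s.
Proof. exact: le_lt_trans (induced_norm_ge0 n_gt0 f_bibo) f_lt_s. Qed.

(** For nonzero [x] the quotient is the gain at [x] divided by [s], hence below 1. Strictness makes
    [defect x] nonzero, so that it can be cancelled in [dilation_inj]. *)
Lemma sqr_defect_gt0 x : 0 < 1 - (norm2 (f x) / (s * norm2 x)) ^+ 2.
Proof.
have [->|x0] := eqVneq x 0.
  by rewrite norm2_0 mulr0 invr0 mulr0 expr0n subr0.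
have nx := norm2_gt0 x0.
rewrite subr_gt0 expr_lt1 ?divr_ge0 ?mulr_ge0 ?norm2_ge0 ?(ltW s_gt0) //.
rewrite ltr_pdivrMr ?mulr_gt0 // mul1r -ltr_pdivrMr //.
exact: le_lt_trans (gain_le_induced_norm n_gt0 f_bibo x0) f_lt_s.
Qed.

Lemma dilation_norm_preserving : norm_preserving dilation.
Proof.
move=> x; apply/eqP; rewrite -(@eqrXn2 _ 2) ?norm2_ge0 //; apply/eqP.
rewrite sqr_norm2_col_mx !sqr_norm2Z.
rewrite [defect x ^+ 2]sqr_sqrtr ?(ltW (sqr_defect_gt0 x)) //.
(* The factor [norm2 x ^+ 2] must cancel the denominator inside the defect, which fails at the
   origin; there both blocks vanish because [f 0 = 0]. *)
have [->|x0] := eqVneq x 0.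
  by rewrite (bibo0 f_bibo) !norm2_0 expr0n !mulr0 addr0.
have := lt0r_neq0 s_gt0; have := lt0r_neq0 (norm2_gt0 x0) => nx0 s0.
by field; rewrite nx0.
Qed.

Lemma dilation_inj : injective dilation.
Proof.
move=> x y vxy; have := dilation_norm_preserving y.
rewrite -vxy dilation_norm_preserving => nxy.
have [fxy dxy] := eq_col_mx vxy.
have efxy : f x = f y by apply: scalerI fxy; rewrite invr_neq0 ?lt0r_neq0.
(* Equal norms and equal images turn both scalars into [defect y], which is positive. *)
move: dxy; rewrite /defect efxy nxy; apply: scalerI.
by rewrite lt0r_neq0 // sqrtr_gt0 sqr_defect_gt0.
Qed.

(** In blocks the matrix is [s] times (1 | 0): the lower block of [dilation x] is discarded and [s]
    cancels [s^-1]. *)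
Lemma dilationK x : (s *: pid_mx p : 'M_(p, p + n)) *m dilation x = f x.
Proof.
rewrite pid_mx_row -scalemxAl mul_row_col mul1mx mul0mx addr0 scalerA.
by rewrite divff ?scale1r ?lt0r_neq0.
Qed.

End Dilation.

Theorem corollary1 (R : realType) (n p : nat) (n_gt0 : (0 < n)%N)
    (p_gt0 : (0 < p)%N) (f : 'cV[R]_n -> 'cV[R]_p) (f_bibo : bibo f) :
  exists (m : nat) (lepnm : (p + n <= m)%N) (U : 'M[R]_p)
         (S : 'M[R]_(p, m)) (v : 'cV[R]_n -> 'cV[R]_m),
    let sigma := diag_entry (leq_trans (leq_addr n p) lepnm) S in
    let sigma1 := sigma (Ordinal p_gt0) in
    orthogonal_mx U /\
    is_diag_mx S /\
    (forall i j, 0 <= S i j) /\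
    (forall i j : 'I_p, (i <= j)%N -> sigma j <= sigma i) /\
    norm_preserving v /\
    injective v /\
    (forall x, f x = U *m S *m v x) /\
    (forall i j, S i j <= sigma1) /\
    (forall x : 'cV[R]_n, x != 0 ->
       induced_norm f * norm2 x < norm2 x * sigma1).
Proof.
(* Any number above the induced norm would do; strict excess keeps [s] positive even for [f = 0]. *)
pose s := induced_norm f + 1.
have f_lt_s : induced_norm f < s by rewrite ltrDl.
have s_ge0 : 0 <= s := le_trans (induced_norm_ge0 n_gt0 f_bibo) (ltW f_lt_s).
pose S : 'M[R]_(p, p + n) := s *: pid_mx p.
(* The rank cutoff [i < p] in [pid_mx p] holds for every row index. *)
have SE i j : S i j = if i == j :> nat then s else 0.
  by rewrite !mxE ltn_ord andbT; case: eqP; rewrite ?mulr1 ?mulr0.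
exists (p + n)%N, (leqnn _), 1%:M, S, (dilation f s) => sigma sigma1.
(* The diagonal is constant, so the ordering of its entries holds with equality. *)
have sigmaE i : sigma i = s by rewrite /sigma /diag_entry SE eqxx.
rewrite /sigma1 sigmaE; do !split.
- by rewrite trmx1 mulmx1.
- by rewrite trmx1 mulmx1.
- by apply/is_diag_mxP => i j /negbTE ij; rewrite SE ij.
- by move=> i j; rewrite SE; case: ifP.
- by move=> i j _; rewrite !sigmaE.
- exact: dilation_norm_preserving.
- exact: dilation_inj.
- by move=> x; rewrite mul1mx dilationK.
- by move=> i j; rewrite SE; case: ifP.
- by move=> x x0; rewrite mulrC ltr_pM2l ?norm2_gt0.
Qed.
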